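(* Let $1\le k\le n$ be integers. Then $$\sum_{\Pi}\mathrm{wt}(\Pi)=\frac1n\binom nk\prod_{i=n-k}^{n-2}\big(iX_i+(n-i)\big),$$ where the sum is over all final chains $\Pi$ of length $k$ in $NC_n$.
   Context: $NC_n$ is the lattice of noncrossing partitions of $\{1,\dots,n\}$, i.e. set partitions with no $i<j<k<\ell$ such that $i,k$ are in one block and $j,\ell$ in another, ordered by refinement ($\pi\le\pi'$ if each block of $\pi$ is contained in a block of $\pi'$); $\hat 1$ is the one-block partition and $\lessdot$ denotes the covering relation of $NC_n$. A final chain of length $k$ in $NC_n$ is a $k$-tuple $(\pi_{n-k},\dots,\pi_{n-1})$ of elements of $NC_n$ with $\pi_{n-k}\lessdot\cdots\lessdot\pi_{n-1}=\hat 1$. If $\rho\lessdot\pi$ in $NC_n$, then $\rho$ is obtained from $\pi$ by splitting one block $B$ of $\pi$ into two blocks $B_1,B_2$; we write $\rho\sqsubset\pi$ if $\{B_1,B_2\}$ is an interval partition of $B$, i.e. all elements of one of $B_1,B_2$ are smaller than all elements of the other. The weight of a final chain $\Pi=(\pi_{n-k},\dots,\pi_{n-1})$ is $$\mathrm{wt}(\Pi)=\prod_{\substack{n-k\le i\le n-2\\ \pi_i\not\sqsubset\pi_{i+1}}}X_i,$$ where the $X_i$ are commuting indeterminates. *)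

(* Defs.v *)
From HB Require Import structures.
From mathcomp Require Import all_boot all_order all_algebra.
From mathcomp Require Export mpoly.

Set Implicit Arguments.
Unset Strict Implicit.
Unset Printing Implicit Defensive.

Import Order.TTheory GRing.Theory.

(* The ground set {1, ..., n} is represented by 'I_n = {0, ..., n-1}: the     *)
(* notions below only depend on its linear order.                             *)

Definition noncrossing n (P : {set {set 'I_n}}) : bool :=
  [forall A in P, forall B in P, (A != B) ==>
    ~~ [exists i in A, exists j in B, exists k in A, exists l in B,
         [&& i < j, j < k & k < l]]].

Record NC n := NCPartition {
  blocks : {set {set 'I_n}};
  _ : partition blocks [set: 'I_n] && noncrossing blocks }.

HB.instance Definition _ n := [isSub of NC n for @blocks n].
HB.instance Definition _ n := [Finite of NC n by <:].

Lemma blocks_partition n (rho : NC n) : partition (blocks rho) [set: 'I_n].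
Proof. by case/andP: (valP rho). Qed.

Definition refines n (rho pi : NC n) : bool :=
  [forall B in blocks rho, exists C in blocks pi, B \subset C].

Lemma refinesP n (rho pi : NC n) :
  reflect (forall B, B \in blocks rho ->
             exists2 C, C \in blocks pi & B \subset C) (refines rho pi).
Proof.
apply: (iffP (forall_inP)) => H B /H; first by case/exists_inP=> C; exists C.
by case=> C Cpi BC; apply/exists_inP; exists C.
Qed.

Lemma refines_refl n : reflexive (@refines n).
Proof. by move=> rho; apply/refinesP=> B Brho; exists B. Qed.

Lemma refines_trans n : transitive (@refines n).
Proof.
move=> pi rho sigma /refinesP rp /refinesP ps; apply/refinesP=> B /rp[C].
by move=> /ps[D Ds CD] BC; exists D => //; apply: subset_trans CD.
Qed.

Lemma refines_sub n (rho pi : NC n) :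
  refines rho pi -> refines pi rho -> blocks rho \subset blocks pi.
Proof.
move=> /refinesP rp /refinesP pr; apply/subsetP=> B Br.
have [C Cp BC] := rp B Br; have [D Dr CD] := pr C Cp.
suff eBD: B = D by rewrite (_ : B = C) //; apply/eqP; rewrite eqEsubset BC eBD.
have /and3P[_ triv no0] := blocks_partition rho.
apply: contraNeq no0 => neBD; have := trivIsetP triv _ _ Br Dr neBD.
rewrite -setI_eq0 (setIidPl (subset_trans BC CD)) => /eqP B0.
by rewrite -B0.
Qed.

Lemma refines_anti n : antisymmetric (@refines n).
Proof.
move=> rho pi /andP[rp pr]; apply/val_inj/eqP.
by rewrite eqEsubset !refines_sub.
Qed.

Fact NC_display : Order.disp_t. Proof. exact: Order.Disp tt tt. Qed.

HB.instance Definition _ n := @Order.Le_isPOrder.Build NC_display (NC n)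
  (@refines n) (@refines_refl n) (@refines_anti n) (@refines_trans n).

(* The condition B != set0 only matters for n = 0, where the unique partition *)
(* has no block.                                                              *)
Definition one_block_set n : {set {set 'I_n}} :=
  [set B | (B == [set: 'I_n]) && (B != set0)].

Fact one_block_subproof n :
  partition (one_block_set n) [set: 'I_n] && noncrossing (one_block_set n).
Proof.
apply/andP; split; last first.
  apply/forall_inP=> A; rewrite inE => /andP[/eqP-> _].
  by apply/forall_inP=> B; rewrite inE => /andP[/eqP-> _]; rewrite eqxx.
apply/and3P; split; last by rewrite inE eqxx andbF.
  rewrite eqEsubset subsetT; apply/subsetP=> x _; apply/bigcupP.
  exists setT; rewrite ?inE ?eqxx //=.
  by apply/set0Pn; exists x; rewrite inE.
apply/trivIsetP=> A B; rewrite !inE => /andP[/eqP-> _] /andP[/eqP-> _].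
by rewrite eqxx.
Qed.

Definition one_block n : NC n := NCPartition (one_block_subproof n).

Fact le_one_block n (rho : NC n) : (rho <= one_block n)%O.
Proof.
apply/refinesP=> B Br; exists setT; last exact: subsetT.
rewrite inE eqxx /=; apply: contraTneq Br => T0.
have /and3P[_ _ no0] := blocks_partition rho.
have /eqP->// : B == set0 by rewrite -subset0 -T0 subsetT.
Qed.

HB.instance Definition _ n :=
  Order.hasTop.Build NC_display (NC n) (@le_one_block n).

Definition covers n (rho pi : NC n) : bool :=
  (rho < pi)%O && ~~ [exists sigma : NC n, (rho < sigma < pi)%O].

Definition all_below n (A B : {set 'I_n}) : bool :=
  [forall x in A, forall y in B, x < y].

(* [covers rho pi], and the block B of pi which is split in rho is split into *)
(* two blocks forming an interval partition of B.                             *)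
Definition interval_covers n (rho pi : NC n) : bool :=
  covers rho pi &&
  [exists B in blocks pi, exists B1 in blocks rho, exists B2 in blocks rho,
    [&& B == B1 :|: B2,
        blocks rho == B1 |: (B2 |: (blocks pi :\ B)) &
        all_below B1 B2 || all_below B2 B1]].

(* A k-tuple Pi is read as (pi_(n-k), ..., pi_(n-1)); [chain_elt Pi i] is     *)
(* pi_i, meaningful for n - k <= i <= n - 1 (the default \top is never used   *)
(* in this range).                                                            *)
Definition chain_elt n k (Pi : k.-tuple (NC n)) (i : nat) : NC n :=
  nth \top%O Pi (i - (n - k)).

(* The indices n - k <= i <= n - 2 are those i : 'I_n.-1 with n - k <= i.     *)
Definition final_chain n k (Pi : k.-tuple (NC n)) : bool :=
  [forall i : 'I_n.-1, (n - k <= i) ==>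
     covers (chain_elt Pi i) (chain_elt Pi i.+1)]
  && (chain_elt Pi n.-1 == \top%O).

Local Open Scope ring_scope.

(* The indeterminates are X_0, ..., X_(n-2). *)
Definition wt n k (Pi : k.-tuple (NC n)) : {mpoly rat[n.-1]} :=
  \prod_(i < n.-1 | (n - k <= i)%N &&
      ~~ interval_covers (chain_elt Pi i) (chain_elt Pi i.+1)) 'X_i.

(* Main.v *)
(* A block of size s has s - p noncrossing splittings whose part not containing
   the minimum has size p, and exactly one of them is an interval splitting.
   With weight X for the others their total weight is 1 + (s - p - 1) X, so
   the last refinement of a chain only involves block sizes.  Weighting a block
   of size b by the coefficient P_b of a polynomial P with P_0 = 0, let
     T_k(P) = sum over final chains Pi of wt(Pi) * prod_B P_|B|,
   B ranging over the blocks of pi_(n-k).  Then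
     k T_k(P) = prod_i (i X_i + n - i) * [z^n] P^k
   by induction on k.  Adding one step at the bottom of the chains turns T_k
   into its derivative at P in the direction Q = P ((1 - X) P + X z P'), which
   the induction hypothesis over R[eps], applied to P + eps Q, computes as
   [z^n] Q P^(k-1) up to the product; and
     (k + 1) Q P^(k-1) = (k + 1) (1 - X) P^(k+1) + X z (P^(k+1))'
   has n-th coefficient ((k + 1) + (n - k - 1) X) [z^n] P^(k+1).
   The theorem is the case P = z + ... + z^n. *)
Require Import Defs.
From HB Require Import structures.
From mathcomp Require Import all_boot all_order all_algebra.
From mathcomp Require Import mpoly.
From mathcomp Require Import zify ring.

Set Implicit Arguments.
Unset Strict Implicit.
Unset Printing Implicit Defensive.

Import Order.TTheory GRing.Theory.

(** * Blocks of a noncrossing partition *)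

Lemma block_neq0 n (rho : NC n) (B : {set 'I_n}) :
  B \in blocks rho -> exists x, x \in B.
Proof.
have /and3P[_ _ no0] := blocks_partition rho.
by move=> Brho; apply/set0Pn; apply: contraNneq no0 => <-.
Qed.

Lemma block_inj n (rho : NC n) (B C : {set 'I_n}) (x : 'I_n) :
  B \in blocks rho -> C \in blocks rho -> x \in B -> x \in C -> B = C.
Proof.
have /and3P[_ triv _] := blocks_partition rho.
move=> Brho Crho xB xC.
by rewrite -(def_pblock triv Brho xB) (def_pblock triv Crho xC).
Qed.

Lemma block_exists n (rho : NC n) (x : 'I_n) :
  exists2 B, B \in blocks rho & x \in B.
Proof.
have /and3P[/eqP cov _ _] := blocks_partition rho.
have /bigcupP[B Brho xB] : x \in cover (blocks rho) by rewrite cov inE.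
by exists B.
Qed.

Lemma noncrossingP n (P : {set {set 'I_n}}) :
  reflect (forall (A B : {set 'I_n}) (i j k l : 'I_n),
             A \in P -> B \in P -> i \in A -> j \in B -> k \in A -> l \in B ->
             i < j -> j < k -> k < l -> A = B)
          (noncrossing P).
Proof.
apply: (iffP forall_inP) => [nc A B i j k l AP BP iA jB kA lB ij jk kl|nc A AP].
  apply/eqP; apply: contraT => neAB.
  have /forall_inP/(_ B BP)/implyP/(_ neAB)/existsPn/(_ i) := nc A AP.
  rewrite iA /= => /existsPn/(_ j); rewrite jB /= => /existsPn/(_ k).
  by rewrite kA /= => /existsPn/(_ l); rewrite lB ij jk kl.
apply/forall_inP=> B BP; apply/implyP=> neAB.
apply: contra neAB => /exists_inP[i iA /exists_inP[j jB]].
case/exists_inP=> k kA /exists_inP[l lB /and3P[ij jk kl]].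
by apply/eqP; apply: (nc A B i j k l).
Qed.

Lemma block_noncrossing n (rho : NC n) : noncrossing (blocks rho).
Proof. by case/andP: (valP rho). Qed.

Lemma block_subset_eq n (rho : NC n) (B C : {set 'I_n}) :
  B \in blocks rho -> C \in blocks rho -> B \subset C -> B = C.
Proof.
move=> Brho Crho BC; have [x xB] := block_neq0 Brho.
by apply: (block_inj Brho Crho xB); apply: (subsetP BC).
Qed.

Lemma leNCP n (rho pi : NC n) :
  reflect (forall B, B \in blocks rho ->
             exists2 C, C \in blocks pi & B \subset C) (rho <= pi)%O.
Proof. exact: refinesP. Qed.

Lemma blocks_subset_eq n (rho pi : NC n) :
  blocks rho \subset blocks pi -> rho = pi.
Proof.
move=> /subsetP sub; apply/val_inj/setP=> C /=; apply/idP/idP=> [/sub//|Cpi].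
have [x xC] := block_neq0 Cpi; have [B Brho xB] := block_exists rho x.
by rewrite (block_inj Cpi (sub _ Brho) xC xB).
Qed.

(** * Splittings of a block and the covering relation *)

(** For [a < b] in [B] the arc has maximum [b], and [a] is the last element of [B] before it. So it
    determines [a] and [b], and it is the part without the minimum of [B]. *)
Definition arc n (B : {set 'I_n}) (a b : 'I_n) : {set 'I_n} :=
  [set x in B | a < x <= b].

Definition split_blocks n (P : {set {set 'I_n}}) (B : {set 'I_n})
    (a b : 'I_n) : {set {set 'I_n}} :=
  arc B a b |: ((B :\: arc B a b) |: (P :\ B)).

(* The covers of pi are indexed by the pairs a < b in a common block B of pi:
   in terms of permutations, they are the products of pi by a transposition
   (a b). *)
Definition splitting n (pi : NC n) (B : {set 'I_n}) (a b : 'I_n) : bool :=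
  [&& B \in blocks pi, a \in B, b \in B & a < b].

Lemma arc_sub n (B : {set 'I_n}) (a b : 'I_n) : arc B a b \subset B.
Proof. by apply/subsetP=> x; rewrite inE => /andP[]. Qed.

(** Two crossing parts would lie in a common block of [pi], as [pi] is noncrossing. This block
    cannot be one left intact; and in [B] the arc is convex, so no alternation [i < j < k < l]
    between the arc and its complement exists. *)
Lemma split_blocks_partition n (pi : NC n) (B : {set 'I_n}) (a b : 'I_n) :
  splitting pi B a b ->
  partition (split_blocks (blocks pi) B a b) [set: 'I_n] &&
    noncrossing (split_blocks (blocks pi) B a b).
Proof.
case/and4P=> Bpi aB bB ab; apply/andP; split.
  have part := partitionD1 (blocks_partition pi) Bpi.
  have part1 : partition ((B :\: arc B a b) |: (blocks pi :\ B))
                         ((B :\: arc B a b) :|: ([set: 'I_n] :\: B)).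
    apply: partitionU1 => //; first by apply/set0Pn; exists a; rewrite !inE ltnn aB.
    rewrite -setI_eq0; apply/eqP/setP=> x; rewrite !inE.
    by case: (x \in B); rewrite ?andbF.
  have -> : [set: 'I_n] = arc B a b :|: ((B :\: arc B a b) :|: ([set: 'I_n] :\: B)).
    apply/setP=> x; rewrite !inE; case: (x \in B); rewrite ?andbF //=.
    by rewrite andbT orbF orbN.
  apply: partitionU1 => //.
    by apply/set0Pn; exists b; rewrite !inE bB ab leqnn.
  rewrite -setI_eq0; apply/eqP/setP=> x; rewrite !inE.
  by case: (x \in B); case: (_ <= b); case: (a < x).
have up A : A \in split_blocks (blocks pi) B a b ->
    exists2 C, C \in blocks pi & A \subset C.
  case/setU1P=> [->|/setU1P[->|/setD1P[_ Api]]].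
  - by exists B => //; apply: arc_sub.
  - by exists B => //; apply: subsetDl.
  - by exists A.
apply/noncrossingP=> A A' i j k l AP AP' iA jA' kA lA' ij jk kl.
have [[C Cpi /subsetP AC] [C' Cpi' /subsetP AC']] := (up _ AP, up _ AP').
have eCC' : C = C'.
  apply: (noncrossingP _ (block_noncrossing pi) C C' i j k l) => //; auto.
have [eCB|neCB] := eqVneq C B; last first.
  have inC (D : {set 'I_n}) x : D \in split_blocks (blocks pi) B a b ->
      x \in D -> x \in C -> D = C.
    case/setU1P=> [->|/setU1P[->|/setD1P[_ Dpi]]].
    - by rewrite inE => /andP[xB _] xC; rewrite (block_inj Cpi Bpi xC xB) eqxx in neCB.
    - by rewrite inE => /andP[_ xB] xC; rewrite (block_inj Cpi Bpi xC xB) eqxx in neCB.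
    - by move=> xD xC; apply: (block_inj Dpi Cpi xD xC).
  have jC : j \in C by rewrite eCC' AC'.
  exact: etrans (inC A i AP iA (AC i iA)) (esym (inC A' j AP' jA' jC)).
have inB (D : {set 'I_n}) x : D \in split_blocks (blocks pi) B a b ->
    x \in D -> x \in B -> D = if a < x <= b then arc B a b else B :\: arc B a b.
  case/setU1P=> [->|/setU1P[->|/setD1P[neDB Dpi]]].
  - by rewrite inE => /andP[_ ->].
  - by rewrite !inE => /andP[/negPf]; case: (x \in B) => //= ->.
  - by move=> xD xB; rewrite (block_inj Dpi Bpi xD xB) eqxx in neDB.
have iB : i \in B by rewrite -eCB AC.
have jB : j \in B by rewrite -eCB eCC' AC'.
have kB : k \in B by rewrite -eCB AC.
have lB : l \in B by rewrite -eCB eCC' AC'.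
have Ei := inB _ _ AP iA iB; have Ek := inB _ _ AP kA kB.
have Ej := inB _ _ AP' jA' jB; have El := inB _ _ AP' lA' lB.
have nab x : x \in B -> arc B a b = B :\: arc B a b -> False.
  by move=> xB /setP/(_ x); rewrite !inE xB; case: (_ && _).
rewrite Ei Ej; rewrite Ei in Ek; rewrite Ej in El.
case: ifP Ei Ek => Hi Ei Ek; case: ifP Ej El => Hj Ej El //.
- case: ifP Ek => [Hk _|_ /nab-/(_ i iB)//].
  by move: Hi Hj Hk ij jk kl; clear; lia.
- case: ifP El => [Hl _|_ /nab-/(_ i iB)//].
  case: ifP Ek => [_ /esym /nab-/(_ i iB)//|Hk _].
  by move: Hi Hj Hk Hl ij jk kl; clear; lia.
Qed.

(* Equal to pi itself unless [splitting pi B a b]. *)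
Definition split_NC n (pi : NC n) (B : {set 'I_n}) (a b : 'I_n) : NC n :=
  insubd pi (split_blocks (blocks pi) B a b).

Lemma blocks_split n (pi : NC n) (B : {set 'I_n}) (a b : 'I_n) :
  splitting pi B a b ->
  blocks (split_NC pi B a b) = split_blocks (blocks pi) B a b.
Proof. by move=> sp; apply: insubdK; apply: split_blocks_partition. Qed.

Lemma mem_arc n (pi : NC n) (B : {set 'I_n}) (a b : 'I_n) :
  splitting pi B a b -> b \in arc B a b /\ a \in B :\: arc B a b.
Proof. by case/and4P=> Bpi aB bB ab; rewrite !inE aB bB ab leqnn ltnn. Qed.

Lemma block_notin_split n (pi : NC n) (B : {set 'I_n}) (a b : 'I_n) :
  splitting pi B a b -> B \notin split_blocks (blocks pi) B a b.
Proof.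
move=> sp; have [bS aS] := mem_arc sp; case/and4P: sp => Bpi aB bB ab.
apply/negP => /setU1P[E|/setU1P[E|]]; last by rewrite !inE eqxx.
  by move: aS; rewrite -E !inE aB.
by move: bB; rewrite {1}E inE bS.
Qed.

Lemma arc_notin n (pi : NC n) (B : {set 'I_n}) (a b : 'I_n) :
  splitting pi B a b ->
  arc B a b \notin (B :\: arc B a b) |: (blocks pi :\ B).
Proof.
move=> sp; have [bS aS] := mem_arc sp; case/and4P: sp => Bpi aB bB ab.
apply/negP=> /setU1P[E|/setD1P[ne Spi]]; first by move: (bS); rewrite E inE bS.
by case/negP: ne; apply/eqP/(block_subset_eq Spi Bpi)/arc_sub.
Qed.

Lemma arcC_notin n (pi : NC n) (B : {set 'I_n}) (a b : 'I_n) :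
  splitting pi B a b -> B :\: arc B a b \notin blocks pi :\ B.
Proof.
move=> sp; have [bS aS] := mem_arc sp; case/and4P: sp => Bpi aB bB ab.
apply/negP=> /setD1P[ne Spi].
by case/negP: ne; apply/eqP/(block_subset_eq Spi Bpi)/subsetDl.
Qed.

(** [B] is the only block of [pi] lost in the splitting. Once the two arcs are known to coincide,
    membership of the four endpoints identifies them. *)
Lemma split_NC_inj n (pi : NC n) (B B' : {set 'I_n}) (a b a' b' : 'I_n) :
  splitting pi B a b -> splitting pi B' a' b' ->
  split_NC pi B a b = split_NC pi B' a' b' -> [/\ B = B', a = a' & b = b'].
Proof.
move=> sp sp' /(congr1 (@blocks n)); rewrite !blocks_split // => E.
have eB : B = B'.
  apply/eqP; apply: contraT => neBB'.
  have := block_notin_split sp; rewrite E !inE neBB'.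
  by case/and4P: sp => -> _ _ _; rewrite !orbT.
rewrite -{B'}eB in sp' E *; split=> //.
all: have [bS aS] := mem_arc sp; have [bS' aS'] := mem_arc sp'.
all: have eS : arc B a b = arc B a' b'.
1,3: have : arc B a b \in split_blocks (blocks pi) B a b by rewrite !inE eqxx.
1,2: rewrite E => /setU1P[//|/setU1P[E'|Spi]];
  last by have := arc_notin sp; rewrite inE Spi orbT.
(* If one arc were the complement of the other, [a] would lie in the second arc and [a'] in the
   first, giving both [a' < a] and [a < a']. *)
1,2: by move: E' aS aS' bS bS' => /setP E'; have := E' a; have := E' a';
  case/and4P: sp sp' => _ aB bB ab /and4P[_ aB' bB' ab'];
  rewrite !inE aB aB' bB bB'; lia.
all: move/setP in eS; have := eS a; have := eS a'; have := eS b; have := eS b'.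
all: by case/and4P: sp sp' => _ aB bB ab /and4P[_ aB' bB' ab'];
  rewrite !inE aB aB' bB bB' => *; apply/val_inj => /=; lia.
Qed.

Lemma split_lt n (pi : NC n) (B : {set 'I_n}) (a b : 'I_n) :
  splitting pi B a b -> (split_NC pi B a b < pi)%O.
Proof.
move=> sp; rewrite lt_def; apply/andP; split.
  apply: contraNneq (block_notin_split sp) => E.
  by rewrite -blocks_split // -E; case/and4P: sp.
apply/leNCP => A; rewrite blocks_split //; case/and4P: sp => Bpi _ _ _.
case/setU1P=> [->|/setU1P[->|/setD1P[_ Api]]].
- by exists B => //; apply: arc_sub.
- by exists B => //; apply: subsetDl.
- by exists A.
Qed.

Lemma block_min n (rho : NC n) (C : {set 'I_n}) :
  C \in blocks rho -> exists2 c, c \in C & forall x, x \in C -> c <= x.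
Proof.
move=> /block_neq0[x xC].
by case: (arg_minnP (fun i : 'I_n => i : nat) xC) => c cC cmin; exists c.
Qed.

(* The block of rho inside B whose minimum c is largest is an interval of B,
   because a block starting before c cannot return inside it. *)
Lemma lt_le_split n (rho pi : NC n) :
  (rho < pi)%O ->
  exists B a b, splitting pi B a b /\ (rho <= split_NC pi B a b)%O.
Proof.
rewrite lt_def => /andP[neq le].
have /subsetPn[B Bpi nBrho] : ~~ (blocks pi \subset blocks rho).
  by apply: contra neq => /blocks_subset_eq->.
have subB (D : {set 'I_n}) x : D \in blocks rho -> x \in D -> x \in B -> D \subset B.
  move=> Drho xD xB; have [C Cpi DC] := leNCP _ _ le D Drho.
  by rewrite (block_inj Bpi Cpi xB (subsetP DC _ xD)).
pose P (c : 'I_n) := (c \in B) &&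
  [exists C in blocks rho, (c \in C) && [forall x in C, c <= x]].
have PI (D : {set 'I_n}) d : D \in blocks rho -> d \in D -> d \in B ->
    (forall x, x \in D -> d <= x) -> P d.
  move=> Drho dD dB dmin; rewrite /P dB; apply/exists_inP; exists D => //.
  by rewrite dD; apply/forall_inP.
have [c0 Pc0] : exists c, P c.
  have [x xB] := block_neq0 Bpi; have [D Drho xD] := block_exists rho x.
  have [d dD dmin] := block_min Drho; exists d.
  by apply: PI dmin => //; apply: (subsetP (subB D x Drho xD xB)).
case: (arg_maxnP (fun i : 'I_n => i : nat) Pc0) => c {c0 Pc0}.
case/andP=> cB /exists_inP[C Crho /andP[cC /forall_inP cmin]] cmax.
have CB := subB _ _ Crho cC cB.
have minD (D : {set 'I_n}) x : D \in blocks rho -> x \in D -> x \in B -> D <> C ->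
    exists2 d, d \in D & d < c.
  move=> Drho xD xB neDC; have [d dD dmin] := block_min Drho.
  have dB : d \in B by apply: (subsetP (subB D x Drho xD xB)).
  have /= dc := cmax d (PI D d Drho dD dB dmin).
  exists d => //; rewrite ltn_neqAle dc andbT.
  apply/negP=> /eqP/val_inj E; apply: neDC.
  by apply: (block_inj Drho Crho dD); rewrite E.
(* [a] will be the last element of [B] before [c]. One exists: otherwise [C] would be all of [B],
   which is not a block of [rho]. *)
have [a0 Pa0] : exists a, [pred i : 'I_n | (i \in B) && (i < c)] a.
  apply/existsP; apply: contraR nBrho => /existsPn nex.
  suff -> : B = C by [].
  apply/eqP; rewrite eqEsubset CB andbT; apply/subsetP=> x xB.
  have [D Drho xD] := block_exists rho x.
  have [<-//|/eqP neDC] := eqVneq D C.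
  have [d dD dc] := minD D x Drho xD xB neDC.
  by have := nex d; rewrite /= dc (subsetP (subB D x Drho xD xB)).
case: (arg_maxnP (fun i : 'I_n => i : nat) Pa0) => a {a0 Pa0} /= /andP[aB ac] amax.
case: (arg_maxnP (fun i : 'I_n => i : nat) cC) => b bC bmax.
have sp : splitting pi B a b.
  by rewrite /splitting Bpi aB (subsetP CB) // (leq_trans ac) // cmin.
exists B, a, b; split=> //.
have eC : arc B a b = C.
  apply/setP=> x; rewrite inE; apply/idP/idP => [/and3P[xB ax xb]|xC]; last first.
    by rewrite (subsetP CB) // (leq_trans ac (cmin _ xC)); apply: bmax.
  have [D Drho xD] := block_exists rho x.
  have [<-//|/eqP neDC] := eqVneq D C.
  have [d dD dc] := minD D x Drho xD xB neDC.
  have xc : c < x.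
    rewrite ltn_neqAle; apply/andP; split.
      apply/negP=> /eqP/val_inj E; apply: neDC.
      by apply: (block_inj Drho Crho xD); rewrite -E.
    rewrite leqNgt; apply/negP=> xltc.
    by have := amax x; rewrite /= xB xltc => /(_ isT); rewrite /= leqNgt ax.
  have xb' : x < b.
    rewrite ltn_neqAle xb andbT.
    apply/negP=> /eqP/val_inj E; apply: neDC.
    by apply: (block_inj Drho Crho xD); rewrite E.
  by case: neDC; apply: (noncrossingP _ (block_noncrossing rho) D C d c x b).
apply/leNCP=> D Drho; rewrite blocks_split // /split_blocks eC.
have [->|neDC] := eqVneq D C; first by exists C; rewrite // !inE eqxx.
have [x xD] := block_neq0 Drho.
have [xB|nxB] := boolP (x \in B).
  exists (B :\: C); first by rewrite !inE eqxx orbT.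
  rewrite subsetD (subB D x) //= -setI_eq0; apply/eqP/setP=> y; rewrite !inE.
  apply/negP=> /andP[yD yC]; case/eqP: neDC; exact: (block_inj Drho Crho yD yC).
have [E Epi DE] := leNCP _ _ le D Drho; exists E => //.
rewrite !inE Epi andbT; have -> : E != B; last by rewrite !orbT.
by apply: contraNneq nxB => <-; apply: (subsetP DE).
Qed.

Lemma card_split n (pi : NC n) (B : {set 'I_n}) (a b : 'I_n) :
  splitting pi B a b -> #|blocks (split_NC pi B a b)| = #|blocks pi|.+1.
Proof.
move=> sp; rewrite blocks_split // cardsU1 (arc_notin sp) cardsU1 (arcC_notin sp).
by case/and4P: sp => Bpi _ _ _; rewrite [in RHS](cardsD1 B) Bpi.
Qed.

(** Sending a block of [rho] to the block of [pi] containing it is onto, so the inequality of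
    cardinals makes it injective: no block of [pi] contains two blocks of [rho]. *)
Lemma le_card_eq n (rho pi : NC n) :
  (rho <= pi)%O -> #|blocks rho| <= #|blocks pi| -> rho = pi.
Proof.
move=> le lecard.
pose h (D : {set 'I_n}) := odflt set0 [pick C in blocks pi | D \subset C].
have hP D : D \in blocks rho -> h D \in blocks pi /\ D \subset h D.
  move=> /(leNCP _ _ le)[C Cpi DC]; rewrite /h; case: pickP => /= [E /andP[]//|].
  by move/(_ C); rewrite Cpi DC.
have hE D C x : D \in blocks rho -> C \in blocks pi -> x \in D -> x \in C -> h D = C.
  move=> /hP[hDpi Dh] Cpi xD xC.
  exact: (block_inj hDpi Cpi (subsetP Dh _ xD) xC).
have im : [set h D | D in blocks rho] = blocks pi.
  apply/setP=> C; apply/imsetP/idP=> [[D /hP[? _] ->]//|Cpi].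
  have [x xC] := block_neq0 Cpi; have [D Drho xD] := block_exists rho x.
  by exists D; rewrite // (hE D C x).
have /imset_injP inj : #|[set h D | D in blocks rho]| == #|blocks rho|.
  by rewrite eqn_leq leq_imset_card im.
apply: blocks_subset_eq; apply/subsetP=> D Drho; have [hDpi Dh] := hP D Drho.
suff -> : D = h D by [].
apply/eqP; rewrite eqEsubset Dh; apply/subsetP=> x xh.
have [D' Drho' xD'] := block_exists rho x.
by rewrite (inj D D') // [RHS](hE D' _ x Drho' hDpi).
Qed.

(** An element strictly between would lie below a splitting of [pi], by [lt_le_split]. One splitting
    would then be strictly finer than another with equally many blocks. *)
Lemma split_covers n (pi : NC n) (B : {set 'I_n}) (a b : 'I_n) :
  splitting pi B a b -> covers (split_NC pi B a b) pi.
Proof.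
move=> sp; rewrite /covers split_lt //=; apply/existsPn=> sigma; apply/negP.
case/andP=> lt /lt_le_split[B' [a' [b' [sp' le']]]].
have lt' := lt_le_trans lt le'.
have E : split_NC pi B a b = split_NC pi B' a' b'.
  by apply: le_card_eq (ltW lt') _; rewrite !card_split.
by move: lt'; rewrite E ltxx.
Qed.

Lemma coversP n (rho pi : NC n) :
  covers rho pi ->
  exists B a b, splitting pi B a b /\ rho = split_NC pi B a b.
Proof.
case/andP=> lt /existsPn nex; have [B [a [b [sp le]]]] := lt_le_split lt.
exists B, a, b; split=> //; apply/eqP; apply: contraT => ne.
by have := nex (split_NC pi B a b); rewrite split_lt // lt_neqAle ne le.
Qed.

(** The complement contains [a], which precedes the arc, so only the complement can come first; it
    does so exactly when nothing in [B] exceeds [b]. *)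
Lemma interval_covers_split n (pi : NC n) (B : {set 'I_n}) (a b : 'I_n) :
  splitting pi B a b ->
  interval_covers (split_NC pi B a b) pi = [forall x in B, x <= b].
Proof.
move=> sp; rewrite /interval_covers split_covers // blocks_split //=.
have [bS aS] := mem_arc sp; have nB := block_notin_split sp.
have Sin : arc B a b \in split_blocks (blocks pi) B a b by rewrite !inE eqxx.
have Tin : B :\: arc B a b \in split_blocks (blocks pi) B a b.
  by rewrite !inE eqxx orbT.
have BST : B = (B :\: arc B a b) :|: arc B a b.
  by apply/setP=> x; rewrite !inE; case: (x \in B); case: (a < x <= b).
have /and4P[Bpi aB bB ab] := sp.
apply/exists_inP/forall_inP => [[B0 B0pi]|bmax].
  case/exists_inP=> B1 _ /exists_inP[B2 _ /and3P[/eqP eB0 /eqP eP]].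
  (* The block that disappears must be [B]; then [B1] and [B2] are identified with the arc and its
     complement. *)
  have eB : B0 = B.
    apply/eqP; apply: contraT => ne; case/negP: nB.
    by rewrite eP !inE (eq_sym B B0) ne Bpi !orbT.
  rewrite {B0 B0pi}eB in eB0 eP.
  have inS : (arc B a b == B1) || (arc B a b == B2).
    move: Sin; rewrite eP => /setU1P[->|/setU1P[->|S]]; rewrite ?eqxx ?orbT //.
    by have := arc_notin sp; rewrite inE S orbT.
  have inT : (B :\: arc B a b == B1) || (B :\: arc B a b == B2).
    move: Tin; rewrite eP => /setU1P[->|/setU1P[->|T]]; rewrite ?eqxx ?orbT //.
    by have := arcC_notin sp; rewrite T.
  have neST : arc B a b != B :\: arc B a b.
    by apply/eqP=> /setP/(_ b); rewrite !inE bB ab leqnn.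
  have nST : ~~ all_below (arc B a b) (B :\: arc B a b).
    by apply/negP=> /forall_inP/(_ b bS)/forall_inP/(_ a aS); rewrite ltnNge ltnW.
  have TSb : all_below (B :\: arc B a b) (arc B a b) -> forall x, x \in B -> x <= b.
    move=> below x xB; rewrite leqNgt; apply/negP=> bx.
    have xT : x \in B :\: arc B a b by rewrite !inE xB /= (leqNgt x b) bx andbF.
    by have /forall_inP/(_ x xT)/forall_inP/(_ b bS) := below; rewrite ltnNge ltnW.
  case/orP: inS => /eqP eS; case/orP: inT => /eqP eT; rewrite -?eS -?eT.
  - by rewrite eT eS eqxx in neST.
  - by rewrite (negPf nST) => /TSb.
  - by rewrite (negPf nST) orbF => /TSb.
  - by rewrite eT eS eqxx in neST.
exists B => //; apply/exists_inP; exists (B :\: arc B a b) => //.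
apply/exists_inP; exists (arc B a b) => //; apply/and3P; split.
- by rewrite -BST.
- by rewrite /split_blocks setUCA.
apply/orP; left; apply/forall_inP=> x; rewrite !inE negb_and => /andP[H xB].
apply/forall_inP=> y; rewrite !inE => /and3P[_ ay _].
by move: H; rewrite xB bmax //= andbT -leqNgt => xa; apply: leq_ltn_trans xa ay.
Qed.

Local Open Scope ring_scope.

(** * Weighted sums over the elements covered by a partition *)

Lemma card_ord_itv s (i j : 'I_s) : #|[set m : 'I_s | (i < m <= j)%N]| = (j - i)%N.
Proof.
rewrite cardsE -sum1_card -(big_mkord (fun m => i < m <= j)%N (fun=> 1%N)).
rewrite (eq_bigl (fun m => (true && (i.+1 <= m) && (m < j.+1))%N)); last first.
  by move=> m; rewrite ltnS.
by rewrite -big_nat_widen // -big_nat_widenl // sum_nat_const_nat muln1 subSS.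
Qed.

(** The increasing enumeration of [B] replaces elements by positions. [F] receives all that the
    weight depends on: the size of the arc and whether the arc ends at the maximum of [B]. *)
Lemma sum_arcs n (R : comNzRingType) (B : {set 'I_n}) (F : nat -> bool -> R) :
  \sum_(a in B) \sum_(b in B | (a < b)%N) F #|arc B a b| [forall x in B, x <= b]%N =
  \sum_(i < #|B|) \sum_(j < #|B| | (i < j)%N) F (j - i)%N (j.+1 == #|B|).
Proof.
have [->|[x0 x0B]] := set_0Vmem B; first by rewrite big_set0 cards0 big_ord0.
pose ev : 'I_#|B| -> 'I_n := @Order.enum_val _ _ (mem B).
have ev_le i j : (ev i <= ev j)%N = (i <= j)%N.
  exact: (Order.EnumVal.le_enum_val (@le_total _ _) i j).
have ev_lt i j : (ev i < ev j)%N = (i < j)%N by rewrite !ltnNge ev_le.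
have evB i : ev i \in B by apply: Order.EnumVal.enum_valP.
have ev_bij := Order.EnumVal.enum_val_bij_in x0B.
have ev_onto x : x \in B -> exists i, x = ev i.
  by case: ev_bij => g _ gK /gK <-; exists (g x).
rewrite (reindex ev) //=; apply: eq_big => [i|i _]; first by rewrite evB.
rewrite (reindex ev) /=; last by apply: subon_bij ev_bij => x /andP[].
apply: eq_big => [j|j _]; first by rewrite evB ev_lt.
congr F.
  have -> : arc B (ev i) (ev j) = ev @: [set m : 'I_#|B| | (i < m <= j)%N].
    apply/setP=> x; rewrite inE; apply/idP/imsetP => [/andP[/ev_onto[m ->]]|[m]].
      by rewrite ev_lt ev_le => ?; exists m; rewrite ?inE.
    by rewrite inE => ? ->; rewrite evB ev_lt ev_le.
  by rewrite card_imset ?card_ord_itv //; apply: Order.EnumVal.enum_val_inj.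
apply/forall_inP/eqP => [H|E x /ev_onto[m ->]]; last first.
  by rewrite ev_le -ltnS E.
have s0 : (#|B|.-1 < #|B|)%N by rewrite ltn_predL (leq_ltn_trans _ (ltn_ord i)).
have := H (ev (Ordinal s0)) (evB _); rewrite ev_le /= => le.
by have := ltn_ord j; lia.
Qed.

(** For [0 < p < s], the [s - p] pairs with [j - i = p], one of them ending at [s - 1], have total
    weight [1 - x + (s - p) * x]. The factor [s - p] comes from the operator z d/dz. The sizes 0 and
    [s] contribute nothing because [P] has no constant term. *)
Lemma sum_split_coef s (R : comNzRingType) (P : {poly R}) (x : R) :
  P`_0 = 0 ->
  \sum_(i < s) \sum_(j < s | (i < j)%N)
    (if j.+1 == s then 1 else x) * (P`_(j - i) * P`_(s - (j - i))) =
  (P * ((1 - x) *: P + x *: ('X * P^`())))`_s.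
Proof.
move=> P0; have coefQ m : ((1 - x) *: P + x *: ('X * P^`()))`_m =
    P`_m * (1 - x + m%:R * x).
  rewrite coefD !coefZ coefXM coef_deriv; case: m => [|m] /=; first by rewrite P0; ring.
  rewrite -[P`_m.+1 *+ _]mulr_natr; ring.
rewrite coefM big_ord_recl P0 mul0r add0r.
under [RHS]eq_bigr => p _ do rewrite coefQ.
rewrite (exchange_big_dep xpredT) //=.
transitivity (\sum_(j < s) \sum_(p < s | (p < j)%N)
    (if j.+1 == s then 1 else x) * (P`_p.+1 * P`_(s - p.+1))).
  apply: eq_bigr => j _; pose G p := (if j.+1 == s then 1 else x) * (P`_p * P`_(s - p)).
  have js := ltnW (ltn_ord j).
  rewrite -(big_ord_widen s (fun i => G (j - i)%N) js).
  rewrite -(big_ord_widen s (fun i => G i.+1) js) (reindex_inj rev_ord_inj) /=.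
  apply: eq_bigr => i _; congr G.
  by have := ltn_ord i; lia.
rewrite (exchange_big_dep xpredT) //=; apply: eq_bigr => p _.
rewrite /bump leq0n add1n -mulr_suml mulrC -mulrA; congr (_ * _).
have [->|ps] := eqVneq p.+1 s; first by rewrite subnn P0 !mul0r.
congr (_ * _).
rewrite -(big_mkord (fun j => true && (p < j))%N (fun j => if j.+1 == s then 1 else x)).
have {ps}ps : (p.+1 < s)%N by rewrite ltn_neqAle ps ltn_ord.
rewrite -big_nat_widenl //; case: s p ps => // s p ps.
rewrite big_nat_recr //= eqxx big_nat (eq_bigr (fun=> x)); last first.
  by move=> j /andP[_ js]; rewrite eqSS ltn_eqF.
rewrite -big_nat sumr_const_nat -mulr_natl addrC -addrA; congr (_ + _).
rewrite subSS -[in RHS](@subnSK p s) // -[in RHS]natr1; ring.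
Qed.

(** The value 1 at interval steps turns the weight of a chain into a product over all its steps. *)
Definition step_weight n (R : comNzRingType) (rho pi : NC n) (x : R) : R :=
  if interval_covers rho pi then 1 else x.

(** By [coversP] and [split_NC_inj] the covered elements correspond to the triples [(B, a, b)]. The
    blocks other than [B] are unchanged and factor out, and the sum over [a] and [b] sees only the
    size of [B]. *)
Lemma sum_covers n (R : comNzRingType) (P : {poly R}) (x : R) (pi : NC n) :
  P`_0 = 0 ->
  \sum_(rho | covers rho pi)
    step_weight rho pi x * \prod_(D in blocks rho) P`_#|D| =
  \sum_(B in blocks pi) (P * ((1 - x) *: P + x *: ('X * P^`())))`_#|B| *
    \prod_(D in blocks pi :\ B) P`_#|D|.
Proof.
move=> P0.
pose S := [set t : {set 'I_n} * ('I_n * 'I_n) | splitting pi t.1 t.2.1 t.2.2].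
pose h (t : {set 'I_n} * ('I_n * 'I_n)) := split_NC pi t.1 t.2.1 t.2.2.
rewrite (eq_bigl (mem [set h t | t in S])) => [|rho]; last first.
  apply/idP/imsetP => [/coversP[B [a [b [sp ->]]]]|[t]].
    by exists (B, (a, b)); rewrite ?inE.
  by rewrite inE => sp ->; apply: split_covers.
rewrite big_imset /=; last first.
  move=> [B [a b]] [B' [a' b']]; rewrite !inE /h /= => sp sp' E.
  by have [-> -> ->] := split_NC_inj sp sp' E.
rewrite (eq_bigl (fun t => (t.1 \in blocks pi) &&
    ((t.2.1 \in t.1) && ((t.2.2 \in t.1) && (t.2.1 < t.2.2)%N)))) => [|t]; last first.
  by rewrite inE.
rewrite -(pair_big_dep (mem (blocks pi)) (fun B ab => (ab.1 \in B) &&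
  ((ab.2 \in B) && (ab.1 < ab.2)%N)) (fun B ab =>
  step_weight (h (B, ab)) pi x * \prod_(D in blocks (h (B, ab))) P`_#|D|)) /=.
apply: eq_bigr => B Bpi.
rewrite -(pair_big_dep (mem B) (fun a b => (b \in B) && (a < b)%N) (fun a b =>
  step_weight (h (B, (a, b))) pi x *
     \prod_(D in blocks (h (B, (a, b)))) P`_#|D|)) /=.
rewrite -sum_split_coef // -(sum_arcs B (fun d e => (if e then 1 else x) *
  (P`_d * P`_(#|B| - d)))) mulr_suml.
apply: eq_bigr => a aB; rewrite mulr_suml; apply: eq_bigr => b /andP[bB ab].
have sp : splitting pi B a b by rewrite /splitting Bpi aB bB.
rewrite /h /= /step_weight interval_covers_split // blocks_split //.
rewrite big_setU1 ?arc_notin // big_setU1 ?arcC_notin //=.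
by rewrite cardsD (setIidPr (arc_sub B a b)) !mulrA.
Qed.

(** * First-order expansion in an auxiliary variable *)

Lemma coef1M (R : nzRingType) (p q : {poly R}) : (p * q)`_1 = p`_0 * q`_1 + p`_1 * q`_0.
Proof. by rewrite coefM !big_ord_recl big_ord0 addr0. Qed.

(** Product rule, with ['X] as an infinitesimal of which only the first-order coefficient is read.
    Unlike the dual numbers, [{poly R}] is still a domain when [R] is one. *)
Lemma coef1_prod (R : comNzRingType) (I : finType) (A : {set I}) (u v : I -> R) :
  (\prod_(i in A) ((u i)%:P + 'X * (v i)%:P))`_1 =
  \sum_(i in A) v i * \prod_(j in A :\ i) u j.
Proof.
have coef0 i : ((u i)%:P + 'X * (v i)%:P)`_0 = u i.
  by rewrite coefD coefC coefXM addr0.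
have coef1 i : ((u i)%:P + 'X * (v i)%:P)`_1 = v i.
  by rewrite coefD coefC coefXM add0r coefC.
have [m] := ubnP #|A|; elim: m A => // m IH A leAm.
have [->|[i iA]] := set_0Vmem A; first by rewrite !big_set0 coefC.
rewrite (big_setD1 i) //= coef1M coef0 coef1 IH; last first.
  by rewrite [in X in (X < _)%N](cardsD1 i) iA in leAm.
rewrite [RHS](big_setD1 i) //= addrC coef0_prod; congr (_ + _); last first.
  by congr (_ * _); apply: eq_bigr => j _.
rewrite mulr_sumr; apply: eq_bigr => j /setD1P[neji jA].
rewrite [in RHS](big_setD1 i) /=; last by rewrite !inE iA eq_sym neji.
rewrite mulrCA; congr (_ * (_ * _)); apply: eq_bigl => l.
by rewrite !inE andbCA.
Qed.

(** Since [e] need not be nilpotent, a multiple of its square remains. *)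
Lemma exprD_first_order (R : comNzRingType) (u e v : R) k :
  exists r, (u + e * v) ^+ k.+1 = u ^+ k.+1 + e * (v * u ^+ k *+ k.+1) + e * (e * r).
Proof.
elim: k => [|k [r IH]]; first by exists 0; rewrite !expr1 expr0; ring.
exists (v * v * u ^+ k *+ k.+1 + (u + e * v) * r); rewrite exprS IH !exprS; ring.
Qed.

(** The index [m] is the degree in z, the index 1 the degree in the infinitesimal, which is embedded
    as the constant ['X%:P]. *)
Lemma coef1_exp (R : comNzRingType) (P Q : {poly R}) k m :
  ((map_poly polyC P + 'X%:P * map_poly polyC Q) ^+ k.+1)`_m`_1 =
  k.+1%:R * (Q * P ^+ k)`_m.
Proof.
have [r ->] := exprD_first_order (map_poly polyC P) 'X%:P (map_poly polyC Q) k.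
rewrite !coefD !coefCM !coefXM /= addr0 -!rmorphXn -rmorphM -rmorphMn !coef_map /=.
by rewrite !coefC add0r /= coefMn mulr_natl.
Qed.

(** * Sums over final chains *)

Definition chain_weight n k (R : comNzRingType) (X : 'I_n.-1 -> R)
    (Pi : k.-tuple (NC n)) : R :=
  \prod_(i < n.-1 | (n - k <= i)%N)
    step_weight (chain_elt Pi i) (chain_elt Pi i.+1) (X i).

(** A chain of length [k.+1] is a chain of length [k] preceded by an element covered by its first
    one. As the indices of [chain_elt] start at [n - k], the old elements keep theirs, and the new
    step has index [i0]. *)
Lemma sum_chainS n k (R : comNzRingType) (X : 'I_n.-1 -> R) (f : NC n -> R)
    (i0 : 'I_n.-1) :
  (0 < k)%N -> (k < n)%N -> i0 = (n - k.+1)%N :> nat ->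
  \sum_(Pi : k.+1.-tuple (NC n) | final_chain Pi)
    chain_weight X Pi * f (chain_elt Pi (n - k.+1)) =
  \sum_(Pi : k.-tuple (NC n) | final_chain Pi) chain_weight X Pi *
    \sum_(rho | covers rho (chain_elt Pi (n - k)))
      step_weight rho (chain_elt Pi (n - k)) (X i0) * f rho.
Proof.
move=> k0 kn Ei0.
have Ei0S : i0.+1 = (n - k)%N by rewrite Ei0; lia.
have elt0 rho (Pi : k.-tuple (NC n)) : chain_elt (cons_tuple rho Pi) (n - k.+1) = rho.
  by rewrite /chain_elt subnn.
have eltS rho (Pi : k.-tuple (NC n)) i : (n - k <= i)%N ->
    chain_elt (cons_tuple rho Pi) i = chain_elt Pi i.
  move=> ni; rewrite /chain_elt.
  by have -> : (i - (n - k.+1) = (i - (n - k)).+1)%N by lia.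
have le_split (i : 'I_n.-1) : (n - k.+1 <= i)%N = (i == i0) || (n - k <= i)%N.
  by rewrite -val_eqE /= Ei0; move: k0 kn; clear; lia.
have final_cons rho (Pi : k.-tuple (NC n)) :
    final_chain (cons_tuple rho Pi) =
    final_chain Pi && covers rho (chain_elt Pi (n - k)).
  rewrite /final_chain eltS; last by lia.
  rewrite [RHS]andbAC; congr (_ && _).
  apply/forallP/andP => [H|[/forallP H cov] i].
    split; last first.
      by have /implyP := H i0; rewrite Ei0 leqnn -Ei0 Ei0S Ei0 elt0 eltS //; apply.
    apply/forallP=> i; apply/implyP=> ni; have /implyP := H i.
    by rewrite !eltS ?le_split ?ni ?orbT; [apply | lia | lia].
  rewrite le_split; apply/implyP; have [->|_] := eqVneq i i0; move=> /= ni.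
    by rewrite Ei0S Ei0 elt0 eltS.
  by have /implyP := H i; rewrite !eltS //; [apply | lia].
have weight_cons rho (Pi : k.-tuple (NC n)) :
    chain_weight X (cons_tuple rho Pi) =
    chain_weight X Pi * step_weight rho (chain_elt Pi (n - k)) (X i0).
  pose w (i : 'I_n.-1) := step_weight (chain_elt (cons_tuple rho Pi) i)
                          (chain_elt (cons_tuple rho Pi) i.+1) (X i).
  have wi0 : w i0 = step_weight rho (chain_elt Pi (n - k)) (X i0).
    by rewrite /w Ei0S {1}Ei0 elt0 eltS.
  have wS (i : 'I_n.-1) : (n - k <= i)%N ->
      w i = step_weight (chain_elt Pi i) (chain_elt Pi i.+1) (X i).
    by move=> ni; rewrite /w !eltS // leqW.
  transitivity (\prod_(i < n.-1 | (n - k.+1 <= i)%N) w i) => //.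
  clearbody w; rewrite -wi0 (bigD1 i0) /=; last by rewrite le_split eqxx.
  rewrite mulrC; congr (_ * w i0).
  apply: eq_big => [i|i /andP[]].
    rewrite le_split; have [->|_] := eqVneq i i0; last by rewrite andbT.
    by rewrite /= -Ei0S ltnn.
  by rewrite le_split => /orP[->//|ni] _; apply: wS.
rewrite (reindex (fun p : NC n * k.-tuple (NC n) => cons_tuple p.1 p.2)) /=; last first.
  exists (fun t : k.+1.-tuple (NC n) => (thead t, [tuple of behead t])).
    by move=> [rho Pi] _; congr pair; apply/val_inj.
  by move=> t _; rewrite [RHS]tuple_eta; apply/val_inj.
under eq_bigl => p do rewrite final_cons.
under eq_bigr => p _ do rewrite weight_cons elt0.
rewrite (reindex (fun p : k.-tuple (NC n) * NC n => (p.2, p.1))) /=; last first.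
  by exists (fun p => (p.2, p.1)) => [[]|[]].
under eq_bigr => p _ do rewrite -mulrA.
under [RHS]eq_bigr => Pi _ do rewrite mulr_sumr.
by rewrite [RHS]pair_big_dep.
Qed.

Lemma final_chain1 n (Pi : 1.-tuple (NC n)) : final_chain Pi = (Pi == [tuple \top%O]).
Proof.
case/tupleP: Pi => pi t; rewrite (tuple0 t) /final_chain /chain_elt subn1 subnn /=.
rewrite -[RHS]val_eqE /= eqseq_cons andbT.
by apply/andb_idl => _; apply/forallP=> i; rewrite leqNgt ltn_ord.
Qed.

(** The ring varies in the induction, which is used over [{poly R}]. Being a domain of
    characteristic zero passes to [{poly R}] and permits cancelling [k.+1]. *)
Lemma chain_sum k n (R : idomainType) (X : 'I_n.-1 -> R) (P : {poly R}) :
  [pchar R] =i pred0 -> P`_0 = 0 -> (0 < k <= n)%N ->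
  k%:R * \sum_(Pi : k.-tuple (NC n) | final_chain Pi)
    chain_weight X Pi * \prod_(D in blocks (chain_elt Pi (n - k))) P`_#|D| =
  \prod_(i < n.-1 | (n - k <= i)%N) (i%:R * X i + (n - i)%:R) * (P ^+ k)`_n.
Proof.
elim: k => // -[_|k IH] in n R X P * => char0 P0 /andP[_ kn].
  (* For length 1 the only chain is the top element: no step, and one block of size [n]. *)
  rewrite mul1r (eq_bigl (pred1 [tuple \top%O])) => [|Pi]; last exact: final_chain1.
  have no_step (F : 'I_n.-1 -> R) : \prod_(i < n.-1 | (n - 1 <= i)%N) F i = 1.
    by rewrite big_pred0 // => i; rewrite subn1 leqNgt ltn_ord.
  rewrite big_pred1_eq /chain_weight !no_step !mul1r expr1 /chain_elt subnn /=.
  rewrite (big_pred1 [set: 'I_n]) ?cardsT ?card_ord // => D /=.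
  rewrite inE; case: eqVneq => //= ->; apply/set0Pn.
  by exists (Ordinal kn); rewrite inE.
have i0P : (n - k.+2 < n.-1)%N by lia.
pose i0 := Ordinal i0P; set x := X i0.
rewrite (sum_chainS X (fun rho => \prod_(D in blocks rho) P`_#|D|) (i0 := i0)) //.
under eq_bigr => Pi _ do rewrite sum_covers //.
set Q := P * _.
have polarized : \sum_(Pi : k.+1.-tuple (NC n) | final_chain Pi) chain_weight X Pi *
    (\sum_(B in blocks (chain_elt Pi (n - k.+1))) Q`_#|B| *
      \prod_(D in blocks (chain_elt Pi (n - k.+1)) :\ B) P`_#|D|) =
    \prod_(i < n.-1 | (n - k.+1 <= i)%N) (i%:R * X i + (n - i)%:R) * (Q * P ^+ k)`_n.
  have k0 : k.+1%:R != 0 :> R by rewrite ((pcharf0P _).1 char0).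
  apply: (mulfI k0).
  pose Z := map_poly polyC P + 'X%:P * map_poly polyC Q.
  have coefZ d : Z`_d = (P`_d)%:P + 'X * (Q`_d)%:P.
    by rewrite coefD coefCM !coef_map.
  have char0Z : [pchar {poly R}] =i pred0 by move=> p; rewrite pchar_poly char0.
  have Z0 : Z`_0 = 0 by rewrite coefZ P0 /Q coefM big_ord1 P0 mul0r mulr0 addr0.
  have hk : (0 < k.+1 <= n)%N by rewrite /= ltnW.
  (* Taking first-order coefficients differentiates the induction hypothesis at [P] in the direction
     [Q]; the weights and the product over [i] are constants. *)
  have /(congr1 (fun p : {poly R} => p`_1)) :=
    IH n {poly R} (fun i => (X i)%:P) Z char0Z Z0 hk.
  have -> : \prod_(i < n.-1 | (n - k.+1 <= i)%N) (i%:R * (X i)%:P + (n - i)%:R) =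
      (\prod_(i < n.-1 | (n - k.+1 <= i)%N) (i%:R * X i + (n - i)%:R))%:P.
    by rewrite rmorph_prod; apply: eq_bigr => i _; rewrite rmorphD rmorphM !rmorph_nat.
  rewrite -[k.+1%:R in LHS]polyC_natr !coefCM coef1_exp coef_sum mulrCA => <-.
  congr (_ * _); apply: eq_bigr => Pi _.
  have -> : chain_weight (fun i => (X i)%:P) Pi = (chain_weight X Pi)%:P.
    rewrite rmorph_prod; apply: eq_bigr => i _.
    by rewrite /step_weight; case: ifP => _; rewrite ?rmorph1.
  by rewrite coefCM -coef1_prod; under [in RHS]eq_bigr => D _ do rewrite coefZ.
have split_prod (F : 'I_n.-1 -> R) : \prod_(i < n.-1 | (n - k.+2 <= i)%N) F i =
    F i0 * \prod_(i < n.-1 | (n - k.+1 <= i)%N) F i.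
  rewrite (bigD1 i0) //=; congr (_ * _); apply: eq_bigl => i.
  by rewrite -val_eqE /=; lia.
have coefQ : k.+2%:R * (Q * P ^+ k)`_n =
    ((n - k.+2)%:R * x + k.+2%:R) * (P ^+ k.+2)`_n.
  have -> : Q * P ^+ k = (1 - x) *: P ^+ k.+2 + x *: ('X * (P^`() * P ^+ k.+1)).
    by rewrite /Q -!mul_polyC !exprS; ring.
  (* The factor [k.+2] completes the derivative of [P ^+ k.+2], and z d/dz multiplies the [n]-th
     coefficient by [n]. *)
  have derivP : k.+2%:R * ('X * (P^`() * P ^+ k.+1))`_n = n%:R * (P ^+ k.+2)`_n.
    have n0 : (0 < n)%N by apply: leq_trans kn.
    rewrite mulr_natl -coefMn -mulrnAr -[P^`() * _ *+ _](deriv_exp P k.+2).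
    by rewrite coefXM coef_deriv eqn0Ngt n0 prednK // mulr_natl.
  rewrite coefD !coefZ mulrDr [_ * (x * _)]mulrCA derivP natrB //; ring.
(* At [i0 = n - k.+2] the term [n - i] is [k.+2], so [coefQ] supplies exactly the missing factor. *)
by rewrite polarized mulrCA coefQ split_prod /= subKn // mulrCA mulrA.
Qed.

(** * Specialization to the polynomial z + ... + z^n *)

(** The base agrees with z/(1 - z) up to degree [n], so the coefficient counts compositions of [m]
    into [k.+1] positive parts. *)
Lemma coef_geometric_exp (R : comNzRingType) n k m : (m <= n)%N ->
  ((\poly_(i < n.+1) (0 < i)%:R : {poly R}) ^+ k.+1)`_m =
  if m is m'.+1 then 'C(m', k)%:R else 0.
Proof.
set P : {poly R} := \poly_(i < n.+1) _.
have coefP i : P`_i = if (i < n.+1)%N then (0 < i)%:R else 0 by rewrite coef_poly.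
(* Multiplied by a power of [P], this yields Pascal's rule; the truncation term contributes only
   above degree [n]. *)
have recP : P = 'X + 'X * P - 'X^(n.+1).
  apply/polyP=> i; rewrite coefB coefD coefX coefXM coefXn !coefP.
  case: i => [|i] /=; first by rewrite addr0 subr0.
  rewrite !eqSS !ltnS; case: i => [|i].
    by case: (n) => [|n'] /=; rewrite addr0 ?subr0 ?subrr.
  by case: ltngtP => _ /=; rewrite add0r ?subr0 ?subrr.
elim: k m => [|k IHk] m le.
  by rewrite expr1 coefP ltnS le; case: m {le} => [|m]; rewrite ?bin0.
elim: m le => [|m IHm] lt; first by rewrite exprS coefM big_ord1 coefP mul0r.
have -> : P ^+ k.+2 = 'X * P ^+ k.+1 + 'X * P ^+ k.+2 - 'X^(n.+1) * P ^+ k.+1.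
  by rewrite (exprS P k.+1) {1}recP; ring.
rewrite coefB coefD !coefXM coefXnM ltnS lt subr0 /=.
rewrite (IHk m (ltnW lt)) (IHm (ltnW lt)).
by case: m {IHm lt} => [|m]; rewrite ?addr0 ?bin0n // binS addrC natrD.
Qed.

Unset Implicit Arguments.

Theorem corollary17 (n k : nat) (hk : (1 <= k <= n)%N) :
  \sum_(Pi : k.-tuple (NC n) | final_chain Pi) wt Pi =
  (n%:R^-1 * 'C(n, k)%:R) *:
    \prod_(i < n.-1 | (n - k <= i)%N) (i%:R * 'X_i + (n - i)%:R)
  :> {mpoly rat[n.-1]}.
Proof.
have char0 : [pchar {mpoly rat[n.-1]}] =i pred0.
  by move=> p; rewrite pchar_lalg Num.Theory.pchar_num.
case: k hk => // k /andP[_ kn]; have n0 : (0 < n)%N by apply: leq_trans kn.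
pose P : {poly {mpoly rat[n.-1]}} := \poly_(i < n.+1) (0 < i)%:R.
have k0 : k.+1%:R != 0 :> {mpoly rat[n.-1]} by rewrite ((pcharf0P _).1 char0).
apply: (mulfI k0).
have P0 : P`_0 = 0 by rewrite coef_poly.
have := chain_sum (fun i => 'X_i) char0 P0 (kn : (0 < k.+1 <= n)%N).
rewrite coef_geometric_exp // -[X in if X is _.+1 then _ else _](prednK n0).
(* Blocks have between 1 and [n] elements, so every block factor is 1. *)
under eq_bigr => Pi _.
  rewrite big1 => [|D /block_neq0 D0]; last first.
    rewrite coef_poly ltnS -[X in (_ <= X)%N](card_ord n) max_card card_gt0.
    by case: D0 => x xD; case: eqP xD => // ->; rewrite inE.
  rewrite mulr1 (_ : chain_weight _ Pi = wt Pi); last first.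
    rewrite /wt big_mkcondr; apply: eq_bigr => i _.
    by rewrite /step_weight; case: ifP.
  over.
move=> ->; rewrite [LHS]mulr_natr -[LHS]scaler_nat [RHS]mulr_natl scalerMnl.
congr (_ *: _).
have nQ : n%:R != 0 :> rat by rewrite Num.Theory.pnatr_eq0 -lt0n.
(* Absorption: [n * 'C(n.-1, k) = k.+1 * 'C(n, k.+1)]. *)
by rewrite -[RHS]mulr_natr -mulrA -natrM [(_ * k.+1)%N]mulnC -mul_bin_diag natrM mulKf.
Qed.
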